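(* Let $\phi:M\to N$ be a diffeomorphism of real manifolds, and suppose that $M$, $N$ are equipped with generalized almost complex structures $\mathcal J_M$, $\mathcal J_N$. If the graph of $\phi$ is a generalized Lagrangian submanifold of $M\times N$ with respect to the twisted product structure on $M\times N$, then $\phi$ induces an isomorphism between the two generalized almost complex structures, i.e. the bundle isomorphism $d\phi\oplus(d\phi^* )^{-1}:TM\oplus T^*M\to TN\oplus T^*N$ covering $\phi$ intertwines $\mathcal J_M$ and $\mathcal J_N$.
   Context: Manifolds are $C^\infty$, real, finite-dimensional. The pairing on $TM\oplus T^*M$ is $\langle X+\xi,Y+\eta\rangle=-\tfrac12(\xi(Y)+\eta(X))$. A generalized almost complex structure (GACS) on $M$ is an $\mathbb R$-linear bundle automorphism $\mathcal J$ of $TM\oplus T^*M$ that is orthogonal for this pairing and satisfies $\mathcal J^2=-1$. Write $\mathcal J=\begin{pmatrix}\mathcal J_1&\mathcal J_2\\ \mathcal J_3&\mathcal J_4\end{pmatrix}$ with $\mathcal J_1:TM\to TM$, $\mathcal J_2:T^*M\to TM$, $\mathcal J_3:TM\to T^*M$, $\mathcal J_4:T^*M\to T^*M$. The twist of $\mathcal J$ is the GACS $\tilde{\mathcal J}=\begin{pmatrix}\mathcal J_1&-\mathcal J_2\\ -\mathcal J_3&\mathcal J_4\end{pmatrix}$. The twisted product structure on $M\times N$ is the product of the GACS $\tilde{\mathcal J}_M$ on $M$ and $\mathcal J_N$ on $N$, i.e. at $(m,n)$ it is $\tilde{\mathcal J}_{M,m}\oplus\mathcal J_{N,n}$ under $T_{(m,n)}(M\times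 N)=T_mM\oplus T_nN$ and the dual identification. A smooth submanifold $S$ of a manifold $X$ with GACS $\mathcal J$ is generalized Lagrangian if $TS\oplus\operatorname{Ann}(TS)\subseteq(TX\oplus T^*X)|_S$ is stable under $\mathcal J$, where $\operatorname{Ann}(TS)\subseteq T^*X|_S$ is the annihilator of $TS\subseteq TX|_S$. *)

(* Defs.v *)
From HB Require Import structures.
From mathcomp Require Import all_boot all_order all_algebra.
From mathcomp Require Import boolp classical_sets functions cardinality.
From mathcomp Require Import reals topology normedtype landau derive.

Set Implicit Arguments.
Unset Strict Implicit.
Unset Printing Implicit Defensive.

Import Order.TTheory GRing.Theory Num.Theory.
Import numFieldNormedType.Exports.

Local Open Scope classical_set_scope.
Local Open Scope ring_scope.

Section SmoothOn.
Context {R : realType}.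

(* The sets U are meant to be open: continuity and differentiability at the
   points of U are those of f as a function on the whole space. *)
Fixpoint Ck {V W : normedModType R} (k : nat) (U : set V) (f : V -> W) : Prop :=
  if k is k'.+1 then
    (forall x, U x -> differentiable f x) /\
    (forall v, Ck k' U (fun x => 'd f x v))
  else forall x, U x -> {for x, continuous f}.

Definition smooth_on {V W : normedModType R} (U : set V) (f : V -> W) : Prop :=
  forall k, Ck k U f.

Lemma near_eq_diff (V W : normedModType R) (f g : V -> W) x :
  (\forall y \near x, f y = g y) -> differentiable f x ->
  differentiable g x /\ 'd g x = 'd f x :> (V -> W).
Proof.
move=> fg /diff_locallyP [cdf dff].
have fgx : g x = f x by have /nbhs_singleton := fg.
have dgg : g \o shift x = cst (g x) + 'd f x +o_ 0 id.
  apply/eqaddoP => e e0; have /eqaddoP/(_ e e0) := dff.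
  have fg0 : \forall y \near 0, f (y + x) = g (y + x).
    have : shift x @ 0 --> x.
      by rewrite -[x in _ --> x]add0r; apply: cvgD; [exact: cvg_id|exact: cst_continuous].
    by move=> /(_ _ fg).
  apply: filterS2 fg0 => y fgy.
  have -> // : (g \o shift x - (cst (g x) + 'd f x)) y =
               (f \o shift x - (cst (f x) + 'd f x)) y.
  by rewrite -[LHS]/(g (y + x) - (g x + 'd f x y)) -fgy fgx.
have E : 'd g x = 'd f x :> (V -> W) by exact: diff_unique.
split; last exact: E.
by apply/diff_locallyP; rewrite E; split; [exact: cdf|exact: dgg].
Qed.

Lemma eq_Ck (V W : normedModType R) k (U : set V) (f g : V -> W) : open U ->
  (forall x, U x -> f x = g x) -> Ck k U f -> Ck k U g.
Proof.
move=> oU; elim: k f g => [|k IH] f g fg /=.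
  move=> cf x Ux; have := cf x Ux; rewrite /prop_for /continuous_at fg // => cfx.
  apply: cvg_trans cfx; apply: near_eq_cvg.
  by apply: filterS (open_nbhs_nbhs (conj oU Ux)) => y Uy; rewrite fg.
have nfg x : U x -> \forall y \near x, f y = g y.
  by move=> Ux; apply: filterS (open_nbhs_nbhs (conj oU Ux)) => y; exact: fg.
move=> [df Cf]; split=> [x Ux|v].
  by have [] := near_eq_diff (nfg _ Ux) (df _ Ux).
apply: IH (Cf v) => x Ux.
by have [_ ->] := near_eq_diff (nfg _ Ux) (df _ Ux).
Qed.

Lemma CkD (V W : normedModType R) k (U : set V) (f g : V -> W) : open U ->
  Ck k U f -> Ck k U g -> Ck k U (fun x => f x + g x).
Proof.
move=> oU; elim: k f g => [|k IH] f g /= Hf Hg.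
  by move=> x Ux; apply: continuousD; [exact: Hf|exact: Hg].
case: Hf Hg => df Cf [dg Cg]; split=> [x Ux|v].
  by apply: differentiableD; [exact: df|exact: dg].
apply: (eq_Ck oU) (IH _ _ (Cf v) (Cg v)) => x Ux.
by rewrite -[in RHS]/(f + g) diffD; [|exact: df|exact: dg].
Qed.

Lemma Ck_linear_comp (V W W' : normedModType R) (L : {linear W -> W'}) k
    (U : set V) (f : V -> W) : open U -> continuous L ->
  Ck k U f -> Ck k U (fun x => L (f x)).
Proof.
move=> oU cL; elim: k f => [|k IH] f /= Hf.
  by move=> x Ux; apply: continuous_comp; [exact: Hf|exact: cL].
case: Hf => df Cf; split=> [x Ux|v].
  by apply: differentiable_comp; [exact: df|exact: linear_differentiable].
apply: (eq_Ck oU) (IH _ (Cf v)) => x Ux.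
have E := @diff_comp _ _ _ _ f L x (df x Ux) (linear_differentiable _ cL).
by rewrite (congr1 (@^~ v) E) /= diff_lin.
Qed.

Lemma Ck_comp_linear (V V' W : normedModType R) (L : {linear V' -> V}) k
    (U : set V) (f : V -> W) : open U -> continuous L ->
  Ck k U f -> Ck k (L @^-1` U) (fun x => f (L x)).
Proof.
move=> oU cL; elim: k f => [|k IH] f /= Hf.
  by move=> x Ux; apply: continuous_comp; [exact: cL|exact: Hf].
have oLU : open (L @^-1` U) by apply: open_comp => // *; exact: cL.
case: Hf => df Cf; split=> [x Ux|v].
  by apply: differentiable_comp; [exact: linear_differentiable|exact: df].
apply: (eq_Ck oLU) (IH _ (Cf (L v))) => x Ux.
have E := @diff_comp _ _ _ _ L f x (linear_differentiable _ cL) (df _ Ux).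
by rewrite (congr1 (@^~ v) E) /= diff_lin.
Qed.

Lemma CkSub (V W : normedModType R) k (U U' : set V) (f : V -> W) :
  U' `<=` U -> Ck k U f -> Ck k U' f.
Proof.
move=> UU; elim: k f => [|k IH] f /= Hf; first by move=> x /UU; exact: Hf.
by case: Hf => df Cf; split=> [x /UU/df//|v]; exact/IH/Cf.
Qed.

Lemma continuous_row_mx (T : topologicalType) m n
    (f : T -> 'rV[R]_m) (g : T -> 'rV[R]_n) x :
  {for x, continuous f} -> {for x, continuous g} ->
  {for x, continuous (fun y => row_mx (f y) (g y))}.
Proof.
move=> cf cg A /nbhs_ballP[e /= e0 eA].
have Hf : \forall y \near x, ball (f x) e (f y).
  exact: cf (nbhsx_ballx (f x) e e0).
have Hg : \forall y \near x, ball (g x) e (g y).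
  exact: cg (nbhsx_ballx (g x) e e0).
apply: filterS2 Hf Hg => y [_ fy] [_ gy].
apply: eA; split => // i j; rewrite !mxE; case: (fintype.split j) => k.
  exact: fy.
exact: gy.
Qed.

Section RowMx.
Variables m n : nat.

Definition inl_mx (x : 'rV[R]_m) : 'rV[R]_(m + n) := row_mx x 0.
Definition inr_mx (x : 'rV[R]_n) : 'rV[R]_(m + n) := row_mx 0 x.

Fact inl_mx_linear : linear inl_mx.
Proof. by move=> a x y; rewrite /inl_mx scale_row_mx add_row_mx scaler0 addr0. Qed.
Fact inr_mx_linear : linear inr_mx.
Proof. by move=> a x y; rewrite /inr_mx scale_row_mx add_row_mx scaler0 addr0. Qed.

HB.instance Definition _ := GRing.isLinear.Build R _ _ _ inl_mx inl_mx_linear.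
HB.instance Definition _ := GRing.isLinear.Build R _ _ _ inr_mx inr_mx_linear.

End RowMx.

Lemma smooth_on_row_mx m n m' n' (U : set 'rV[R]_m) (V : set 'rV[R]_n)
    (f : 'rV[R]_m -> 'rV[R]_m') (g : 'rV[R]_n -> 'rV[R]_n') :
  open U -> open V -> smooth_on U f -> smooth_on V g ->
  smooth_on ((lsubmx @^-1` U) `&` (rsubmx @^-1` V) : set 'rV[R]_(m + n))
    (fun x => row_mx (f (lsubmx x)) (g (rsubmx x))).
Proof.
move=> oU oV sf sg k.
have oU' : open (lsubmx @^-1` U : set 'rV[R]_(m + n)).
  by apply: open_comp => // x _; exact: (@continuous_lsubmx R 1 m n x).
have oV' : open (rsubmx @^-1` V : set 'rV[R]_(m + n)).
  by apply: open_comp => // x _; exact: (@continuous_rsubmx R 1 m n x).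
have oUV := openI oU' oV'.
have cl : continuous (@inl_mx m' n').
  by move=> x; apply: (@continuous_row_mx _ _ _ id (cst 0) x); [exact: cvg_id|exact: cst_continuous].
have cr : continuous (@inr_mx m' n').
  by move=> x; apply: (@continuous_row_mx _ _ _ (cst 0) id x); [exact: cst_continuous|exact: cvg_id].
apply: (@eq_Ck _ _ _ _
  (fun x => inl_mx n' (f (lsubmx x)) + inr_mx m' (g (rsubmx x)))) => //.
  by move=> x _; rewrite /inl_mx /inr_mx add_row_mx addr0 add0r.
apply: CkD => //; apply: Ck_linear_comp => //.
  apply: (@CkSub _ _ _ (lsubmx @^-1` U)); first by move=> x [].
  by apply: (@Ck_comp_linear _ _ _ lsubmx) => //; exact: (@continuous_lsubmx R 1 m n).
apply: (@CkSub _ _ _ (rsubmx @^-1` V)); first by move=> x [].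
by apply: (@Ck_comp_linear _ _ _ rsubmx) => //; exact: (@continuous_rsubmx R 1 m n).
Qed.

End SmoothOn.

(* A chart is given by total functions in both directions: [cmap] is only
   meaningful on [cdom] and [cinv] on the image of [cdom]. *)
Record chart (R : realType) (n : nat) (T : topologicalType) := Chart {
  cdom : set T;
  cmap : T -> 'rV[R]_n;
  cinv : 'rV[R]_n -> T;
  cdom_open : open cdom;
  cimg_open : open (cmap @` cdom);
  cmapK : forall x, cdom x -> cinv (cmap x) = x;
  cmap_continuous : forall x, cdom x -> {for x, continuous cmap};
  cinv_continuous : forall y, (cmap @` cdom) y -> {for y, continuous cinv}
}.

Lemma transition_open (R : realType) (n : nat) (T : topologicalType)
    (c d : chart R n T) : open (cmap c @` (cdom c `&` cdom d)).
Proof.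
have -> : cmap c @` (cdom c `&` cdom d) =
          (cmap c @` cdom c) `&` (cinv c @^-1` cdom d).
  apply/seteqP; split=> [_ [x [cx dx] <-]|_ [[x cx <-]]].
    by split; [exists x|rewrite /= cmapK].
  by rewrite /= cmapK // => dx; exists x.
rewrite openE => y [cy dy].
apply: filterI.
  by apply: open_nbhs_nbhs; split=> //; exact: cimg_open.
apply: (cinv_continuous cy); apply: open_nbhs_nbhs; split=> //.
exact: cdom_open.
Qed.

Definition compatible (R : realType) (n : nat) (T : topologicalType)
    (c d : chart R n T) : Prop :=
  smooth_on (cmap c @` (cdom c `&` cdom d)) (cmap d \o cinv c) /\
  smooth_on (cmap d @` (cdom c `&` cdom d)) (cmap c \o cinv d).

(* The atlas is not required to be maximal: it determines the smooth structure,
   and the notions below do not depend on its choice within that structure. *)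
Record manifold (R : realType) (n : nat) := Manifold {
  msort :> topologicalType;
  atlas : set (chart R n msort);
  atlas_cover : forall x : msort, exists2 c, atlas c & cdom c x;
  atlas_compatible : forall c d, atlas c -> atlas d -> compatible c d;
  manifold_hausdorff : hausdorff_space msort;
  manifold_second_countable : @second_countable msort
}.

Arguments atlas {R n} m.

Definition smooth_map (R : realType) (m n : nat)
    (M : manifold R m) (N : manifold R n) (f : M -> N) : Prop :=
  continuous f /\
  forall c d, atlas M c -> atlas N d ->
    smooth_on (cmap c @` (cdom c `&` f @^-1` cdom d))
              (cmap d \o f \o cinv c).

Definition diffeomorphism (R : realType) (m n : nat)
    (M : manifold R m) (N : manifold R n) (f : M -> N) : Prop :=
  smooth_map f /\
  exists g : N -> M, [/\ smooth_map g, cancel f g & cancel g f].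

Section Tangent.
Context {R : realType} {n : nat} {M : manifold R n}.
Implicit Types (p : M) (c d : chart R n M).

Definition chart_at p c : Prop := atlas M c /\ cdom c p.

Definition default_chart p : chart R n M := projT1 (cid2 (atlas_cover p)).

Lemma default_chartP p : chart_at p (default_chart p).
Proof. by rewrite /default_chart; case: cid2. Qed.

(* A tangent vector at p is the family of its coordinate vectors in the charts
   of the atlas around p, related by the differentials of the transition maps;
   its value on all other charts is set to 0. *)
Definition tangent_pred p : {pred chart R n M -> 'rV[R]_n} :=
  fun v => `[< (forall c d, chart_at p c -> chart_at p d ->
                  v d = 'd (cmap d \o cinv c) (cmap c p) (v c)) /\
               (forall c, ~ chart_at p c -> v c = 0) >].

Fact tangent_submod_closed p : submod_closed (tangent_pred p).
Proof.
split=> [|a u v /asboolP [ut u0] /asboolP [vt v0]]; apply/asboolP; split=> //.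
- by move=> c d _ _; rewrite linear0.
- by move=> c d pc pd; rewrite linearP -ut // -vt.
- move=> c pc; rewrite -[LHS]/(a *: u c + v c) u0 // v0 //.
  by rewrite scaler0 addr0.
Qed.

HB.instance Definition _ p :=
  GRing.isSubmodClosed.Build R (chart R n M -> 'rV[R]_n) (tangent_pred p)
    (tangent_submod_closed p).

Record tangent p := Tangent {
  tangent_val : chart R n M -> 'rV[R]_n;
  tangent_valP : tangent_val \in tangent_pred p
}.

HB.instance Definition _ p := [isSub for @tangent_val p].
HB.instance Definition _ p := [Choice of tangent p by <:].
HB.instance Definition _ p := [SubChoice_isSubLmodule of tangent p by <:].

Definition tcoord p c (v : tangent p) : 'rV[R]_n := val v c.

Fact tcoord_linear p c : linear (@tcoord p c).
Proof. by []. Qed.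

HB.instance Definition _ p c :=
  GRing.isLinear.Build R _ _ _ (@tcoord p c) (@tcoord_linear p c).

Lemma tcoord_change p c d (v : tangent p) : chart_at p c -> chart_at p d ->
  tcoord d v = 'd (cmap d \o cinv c) (cmap c p) (tcoord c v).
Proof. by case: v => v /[dup] /asboolP [H _] vP; exact: H. Qed.

Definition tvec_val p c (w : 'rV[R]_n) d : 'rV[R]_n :=
  if `[< chart_at p c /\ chart_at p d >]
  then 'd (cmap d \o cinv c) (cmap c p) w else 0.

Lemma transition_differentiable p c d : chart_at p c -> chart_at p d ->
  differentiable (cmap d \o cinv c) (cmap c p).
Proof.
move=> [Mc cp] [Md dp]; have [/(_ 1%N) [H _] _] := atlas_compatible Mc Md.
by apply: H; exists p.
Qed.

Lemma transition_cocycle p c d e (w : 'rV[R]_n) :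
  chart_at p c -> chart_at p d -> chart_at p e ->
  'd (cmap e \o cinv c) (cmap c p) w =
  'd (cmap e \o cinv d) (cmap d p) ('d (cmap d \o cinv c) (cmap c p) w).
Proof.
move=> pc pd pe; have [cp dp] := (pc.2, pd.2).
have Ed : (cmap d \o cinv c) (cmap c p) = cmap d p by rewrite /= cmapK.
have Dd := transition_differentiable pc pd.
have De := transition_differentiable pd pe; rewrite -Ed in De.
have := near_eq_diff _ (differentiable_comp Dd De).
move=> /(_ (cmap e \o cinv c)) [].
  have : nbhs (cmap c p) (cmap c @` (cdom c `&` cdom d)).
    by apply: open_nbhs_nbhs; split; [exact: transition_open|exists p].
  by apply: filterS => _ [x [cx dx] <-] /=; rewrite !cmapK.
move=> _ H.
have H2 := diff_comp Dd De.
etransitivity; first exact: (congr1 (@^~ w) H).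
etransitivity; first exact: (congr1 (@^~ w) H2).
by rewrite [LHS]/= cmapK.
Qed.

Lemma transition_id p c (w : 'rV[R]_n) : chart_at p c ->
  'd (cmap c \o cinv c) (cmap c p) w = w.
Proof.
move=> [Mc cp].
have [] := @near_eq_diff _ _ _ id (cmap c \o cinv c) (cmap c p).
- have : nbhs (cmap c p) (cmap c @` cdom c).
    by apply: open_nbhs_nbhs; split; [exact: cimg_open|exists p].
  by apply: filterS => _ [x cx <-] /=; rewrite cmapK.
- by apply: (@linear_differentiable _ _ _ idfun) => x; exact: cvg_id.
have idc : continuous (@idfun 'rV[R]_n) by move=> x; exact: cvg_id.
move=> _ H.
etransitivity; first exact: (congr1 (@^~ w) H).
exact: (congr1 (@^~ w) (@diff_lin _ _ _ idfun _ idc)).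
Qed.

Fact tvec_subproof p c w : tvec_val p c w \in tangent_pred p.
Proof.
apply/asboolP; rewrite /tvec_val; split=> [d e pd pe|d pd]; last first.
  by case: asboolP => // -[].
case: asboolP => He; case: asboolP => Hd.
- by case: Hd => pc _; exact: transition_cocycle.
- by case: Hd; case: He.
- by case: He; case: Hd.
- by rewrite linear0.
Qed.

(* The tangent vector at p with coordinates w in the chart c. *)
Definition tvec p c (w : 'rV[R]_n) : tangent p := Tangent (tvec_subproof p c w).

Fact tvec_linear p c : linear (tvec p c).
Proof.
move=> a u v; apply/val_inj/funext => d.
rewrite -[RHS]/(a *: tvec_val p c u d + tvec_val p c v d) /= /tvec_val.
by case: asboolP => _; rewrite ?linearP// scaler0 addr0.
Qed.

HB.instance Definition _ p c :=
  GRing.isLinear.Build R _ _ _ (tvec p c) (@tvec_linear p c).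

Lemma tvecK p c : chart_at p c -> cancel (tvec p c) (@tcoord p c).
Proof.
move=> pc w; rewrite /tcoord /= /tvec_val; case: asboolP => [_|[]//].
exact: transition_id.
Qed.

Lemma tcoordK p c : chart_at p c -> cancel (@tcoord p c) (tvec p c).
Proof.
move=> pc v; apply/val_inj/funext => d; rewrite /= /tvec_val.
case: asboolP => [[_ pd]|Nd]; first by rewrite -tcoord_change.
case: v => v /[dup] /asboolP [_ H] vP /=; rewrite H // => pd.
by apply: Nd.
Qed.

Fact tangent_vect_axiom p : Vector.axiom n (tangent p).
Proof.
have pc := default_chartP p.
by exists (@tcoord p (default_chart p)) => //; exists (tvec p (default_chart p));
  [exact: tcoordK|exact: tvecK].
Qed.

HB.instance Definition _ p :=
  Lmodule_hasFinDim.Build R (tangent p) (tangent_vect_axiom p).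

End Tangent.
Arguments tangent {R n M} p.
Arguments tcoord {R n M p} c v.
Arguments tvec {R n M} p c w.

Section LinearAlgebra.
Context {K : fieldType}.
Implicit Types (A B C D V W : vectType K).

Section Pair.
Context {A B C D : vectType K}.

Definition lfun_pair_fun (f : 'Hom(A, C)) (g : 'Hom(B, D)) (u : A * B) : C * D :=
  (f u.1, g u.2).

Fact lfun_pair_linear f g : linear (lfun_pair_fun f g).
Proof. by move=> a u v; rewrite /lfun_pair_fun /= !linearP. Qed.

HB.instance Definition _ f g :=
  GRing.isLinear.Build K _ _ _ (lfun_pair_fun f g) (lfun_pair_linear f g).

(* f + g : A + B -> C + D *)
Definition lfun_pair f g : 'Hom((A * B)%type, (C * D)%type) :=
  linfun (lfun_pair_fun f g).

End Pair.

Section Dual.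
Context {V W : vectType K}.

Definition dual_map_fun (f : 'Hom(V, W)) (eta : 'Hom(W, K^o)) : 'Hom(V, K^o) :=
  (eta \o f)%VF.

Fact dual_map_linear f : linear (dual_map_fun f).
Proof.
by move=> a u v; rewrite /dual_map_fun comp_lfunDl comp_lfunZl.
Qed.

HB.instance Definition _ f :=
  GRing.isLinear.Build K _ _ _ (dual_map_fun f) (dual_map_linear f).

Definition dual_map (f : 'Hom(V, W)) : 'Hom('Hom(W, K^o), 'Hom(V, K^o)) :=
  linfun (dual_map_fun f).

End Dual.

(* V + V^* *)
Definition gspace V := (V * 'Hom(V, K^o))%type.
HB.instance Definition _ V := Vector.on (gspace V).

Definition pairing {V} (u v : gspace V) : K := - 2^-1 * (u.2 v.1 + v.2 u.1).

Section Twist.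
Context {V : vectType K}.
Variable J : 'End(gspace V).

Definition block1 (x : V) : V := (J (x, 0)).1.
Definition block2 (xi : 'Hom(V, K^o)) : V := (J (0, xi)).1.
Definition block3 (x : V) : 'Hom(V, K^o) := (J (x, 0)).2.
Definition block4 (xi : 'Hom(V, K^o)) : 'Hom(V, K^o) := (J (0, xi)).2.

Definition twist_fun (u : gspace V) : gspace V :=
  (block1 u.1 - block2 u.2, - block3 u.1 + block4 u.2).

Lemma twist_funE (u : gspace V) :
  twist_fun u = ((J (u.1, - u.2)).1, - (J (u.1, - u.2)).2).
Proof.
have -> : ((u.1, - u.2) : gspace V) = (u.1, 0) - (0, u.2).
  by congr pair; rewrite /= ?subr0 ?sub0r.
by rewrite linearB /twist_fun /block1 /block2 /block3 /block4 /= opprD opprK.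
Qed.

Fact twist_linear : linear twist_fun.
Proof.
move=> a u v; rewrite !twist_funE.
have -> : (((a *: u + v).1, - (a *: u + v).2) : gspace V) =
          a *: (u.1, - u.2) + (v.1, - v.2).
  by congr pair; rewrite /= opprD scalerN.
by rewrite linearP /=; congr pair; rewrite /= opprD scalerN.
Qed.

HB.instance Definition _ :=
  GRing.isLinear.Build K (gspace V) (gspace V) _ twist_fun twist_linear.

Definition twist : 'End(gspace V) := linfun twist_fun.

End Twist.

Section Splitting.
Context {V V1 V2 : vectType K}.

Definition inl_fun (x : V1) : V1 * V2 := (x, 0).
Definition inr_fun (x : V2) : V1 * V2 := (0, x).

Fact inl_linear : linear inl_fun.
Proof. by move=> a x y; congr pair; rewrite /= ?scaler0 ?addr0. Qed.
Fact inr_linear : linear inr_fun.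
Proof. by move=> a x y; congr pair; rewrite /= ?scaler0 ?addr0. Qed.

HB.instance Definition _ := GRing.isLinear.Build K _ _ _ inl_fun inl_linear.
HB.instance Definition _ := GRing.isLinear.Build K _ _ _ inr_fun inr_linear.

Definition lfun_inl : 'Hom(V1, (V1 * V2)%type) := linfun inl_fun.
Definition lfun_inr : 'Hom(V2, (V1 * V2)%type) := linfun inr_fun.

(* For an identification F of V with V1 + V2, the induced identification of
   V + V^* with (V1 + V1^* ) + (V2 + V2^* ). *)
Variable F : 'Hom(V, (V1 * V2)%type).

Definition gen_split_fun (u : gspace V) : gspace V1 * gspace V2 :=
  (((F u.1).1, (u.2 \o F^-1 \o lfun_inl)%VF),
   ((F u.1).2, (u.2 \o F^-1 \o lfun_inr)%VF)).

Fact gen_split_linear : linear gen_split_fun.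
Proof.
move=> a u v; congr pair; congr pair; rewrite /= ?linearP //.
  by rewrite !comp_lfunZl !comp_lfunDl.
by rewrite !comp_lfunZl !comp_lfunDl.
Qed.

HB.instance Definition _ :=
  GRing.isLinear.Build K (gspace V) (gspace V1 * gspace V2)%type _
    gen_split_fun gen_split_linear.

Definition gen_split : 'Hom(gspace V, (gspace V1 * gspace V2)%type) :=
  linfun gen_split_fun.

(* The operator J1 + J2, transported to V + V^*; f^-1 is the library's total
   inverse of linear maps, the genuine one for the bijective maps used here. *)
Definition gen_sum (J1 : 'End(gspace V1)) (J2 : 'End(gspace V2)) : 'End(gspace V) :=
  (gen_split^-1 \o lfun_pair J1 J2 \o gen_split)%VF.

End Splitting.
End LinearAlgebra.

Section Differential.
Context {R : realType} {m n : nat} {M : manifold R m} {N : manifold R n}.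

(* The differential, read in the default charts at p and f p; by mdiffE it does
   not depend on them when f is smooth. *)
Definition mdiff (f : M -> N) (p : M) : 'Hom(tangent p, tangent (f p)) :=
  let c := default_chart p in let d := default_chart (f p) in
  linfun (tvec (f p) d \o 'd (cmap d \o f \o cinv c) (cmap c p) \o tcoord c).

Lemma smooth_map_differentiable (f : M -> N) p c d : smooth_map f ->
  chart_at p c -> chart_at (f p) d ->
  differentiable (cmap d \o f \o cinv c) (cmap c p).
Proof.
move=> [_ sf] [Mc cp] [Nd dfp]; have [H _] := sf c d Mc Nd 1%N.
by apply: H; exists p.
Qed.

Lemma mdiffE (f : M -> N) p c d (v : tangent p) : smooth_map f ->
  chart_at p c -> chart_at (f p) d ->
  tcoord d (mdiff f p v) = 'd (cmap d \o f \o cinv c) (cmap c p) (tcoord c v).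
Proof.
move=> sf pc qd; have pc0 := default_chartP p; have qd0 := default_chartP (f p).
rewrite /mdiff lfunE /=.
move: (default_chart p) (default_chart (f p)) pc0 qd0 => c0 d0 pc0 qd0.
rewrite (tcoord_change _ qd0 qd) tvecK // (tcoord_change _ pc pc0).
have D1 := transition_differentiable pc pc0.
have D2 := smooth_map_differentiable sf pc0 qd0.
have D3 := transition_differentiable qd0 qd.
have E1 : (cmap c0 \o cinv c) (cmap c p) = cmap c0 p.
  by rewrite /= cmapK //; exact: (proj2 pc).
have E2 : (cmap d0 \o f \o cinv c0) (cmap c0 p) = cmap d0 (f p).
  by rewrite /= cmapK //; exact: (proj2 pc0).
rewrite -E1 in D2 E2; rewrite -E2 in D3.
have D12 := differentiable_comp D1 D2.
have D123 := differentiable_comp D12 D3.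
have := @near_eq_diff _ _ _ _ (cmap d \o f \o cinv c) _ _ D123.
case.
  have op : nbhs (cmap c p) (cmap c @` (cdom c `&` cdom c0)).
    apply: open_nbhs_nbhs; split; first exact: transition_open.
    by exists p => //; split; [exact: (proj2 pc)|exact: (proj2 pc0)].
  have cf : {for cmap c p, continuous (f \o cinv c)}.
    apply: continuous_comp; last exact: (proj1 sf).
    by apply: cinv_continuous; exists p => //; case: pc.
  have of0 : \forall y \near cmap c p, cdom d0 (f (cinv c y)).
    apply: cf; apply: open_nbhs_nbhs; split; first exact: cdom_open.
    by rewrite /= cmapK; [exact: (proj2 qd0)|exact: (proj2 pc)].
  apply: filterS2 op of0 => _ [x [cx c0x] <-].
  by rewrite /= !(cmapK cx) (cmapK c0x) => d0x; rewrite (cmapK d0x).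
move=> _ H; set w := tcoord c v; symmetry.
have H12 : 'd ((cmap d0 \o f \o cinv c0) \o (cmap c0 \o cinv c)) (cmap c p) w =
    'd (cmap d0 \o f \o cinv c0) (cmap c0 p) ('d (cmap c0 \o cinv c) (cmap c p) w).
  etransitivity; first exact: (congr1 (@^~ w) (diff_comp D1 D2)).
  by rewrite [LHS]/= (cmapK (proj2 pc)).
etransitivity; first exact: (congr1 (@^~ w) H).
etransitivity; first exact: (congr1 (@^~ w) (diff_comp D12 D3)).
etransitivity; first exact: (congr1 ('d (cmap d \o cinv d0) _) H12).
by rewrite [in LHS]/= (cmapK (proj2 pc)) (cmapK (proj2 pc0)).
Qed.

(* (df_p)^* : T^*_{f p} N -> T^*_p M *)
Definition comdiff (f : M -> N) (p : M) :
    'Hom('Hom(tangent (f p), R^o), 'Hom(tangent p, R^o)) :=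
  dual_map (mdiff f p).

End Differential.

Notation gtangent p := (gspace (tangent p)).

Section GACS.
Context {R : realType} {n : nat} {M : manifold R n}.
Implicit Types (p : M) (c : chart R n M).

(* The covector at p with coordinates a in the coframe dx^i of the chart c. *)
Definition covec_fun p c (a : 'rV[R]_n) (v : tangent p) : R^o :=
  \sum_(i < n) a 0 i * tcoord c v 0 i.

Fact covec_linear p c a : linear (@covec_fun p c a).
Proof.
move=> k u v; rewrite /covec_fun scaler_sumr -big_split /=.
apply: eq_bigr => i _; rewrite linearP !mxE mulrDr; congr (_ + _).
by rewrite mulrCA.
Qed.

HB.instance Definition _ p c a :=
  GRing.isLinear.Build R (tangent p) R^o _ (@covec_fun p c a) (covec_linear c a).

Definition covec p c (a : 'rV[R]_n) : 'Hom(tangent p, R^o) :=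
  linfun (@covec_fun p c a).

Definition cocoord p c (xi : 'Hom(tangent p, R^o)) : 'rV[R]_n :=
  \row_(i < n) xi (tvec p c (delta_mx 0 i)).

(* The entries of the operators J p in the frame of T M + T^* M attached to any
   chart of the atlas are smooth functions of the coordinates. *)
Definition smooth_gfield (J : forall p, 'End(gtangent p)) : Prop :=
  forall c, atlas M c -> forall w a : 'rV[R]_n,
    let image (x : 'rV[R]_n) :=
      J (cinv c x) (tvec (cinv c x) c w, covec (cinv c x) c a) in
    smooth_on (cmap c @` cdom c) (fun x => tcoord c (image x).1) /\
    smooth_on (cmap c @` cdom c) (fun x => cocoord c (image x).2).

Definition is_gacs (J : forall p, 'End(gtangent p)) : Prop :=
  [/\ smooth_gfield J,
      forall p (u v : gtangent p), pairing (J p u) (J p v) = pairing u v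
    & forall p (u : gtangent p), J p (J p u) = - u].

(* Embedded submanifolds, by slice charts taken in the maximal atlas. *)
Definition is_submanifold (S : set M) : Prop :=
  exists k : nat, (k <= n)%N /\
    forall p, S p -> exists c,
      [/\ forall d, atlas M d -> compatible c d, cdom c p
        & cmap c @` (cdom c `&` S) =
          (cmap c @` cdom c) `&`
          [set x | forall i : 'I_n, (k <= i)%N -> x 0 i = 0]].

Definition smooth_curve (e : R) (g : R -> M) : Prop :=
  let I := [set t : R | - e < t < e] in
  (forall t, I t -> {for t, continuous g}) /\
  forall c, atlas M c -> smooth_on (I `&` g @^-1` cdom c) (cmap c \o g).

Definition velocity (g : R -> M) p (v : tangent p) : Prop :=
  g 0 = p /\ forall c, chart_at p c -> tcoord c v = derive1 (cmap c \o g) 0.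

(* T_p S inside T_p M: the velocities at p of the smooth curves lying in S. *)
Definition tangent_sub (S : set M) p : set (tangent p) :=
  [set v | exists e g, [/\ 0 < e, smooth_curve e g,
     (forall t, - e < t < e -> S (g t)) & velocity g v]].

Arguments tangent_sub S p : clear implicits.

Definition annihilator p (T : set (tangent p)) : set 'Hom(tangent p, R^o) :=
  [set xi | forall v, T v -> xi v = 0].

Definition generalized_lagrangian (J : forall p, 'End(gtangent p))
    (S : set M) : Prop :=
  is_submanifold S /\
  forall p, S p ->
    let TS := tangent_sub S p in
    let TSAnn := [set u : gtangent p | TS u.1 /\ annihilator TS u.2] in
    forall u, TSAnn u -> TSAnn (J p u).

End GACS.

Section GPush.
Context {R : realType} {m n : nat} {M : manifold R m} {N : manifold R n}.

(* d f + ((d f)^* )^-1, for f a diffeomorphism *)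
Definition gpush (f : M -> N) (p : M) : 'Hom(gtangent p, gtangent (f p)) :=
  lfun_pair (mdiff f p) (comdiff f p)^-1%VF.

Definition intertwines (f : M -> N) (J : forall p : M, 'End(gtangent p))
    (J' : forall q : N, 'End(gtangent q)) : Prop :=
  forall p, (gpush f p \o J p = J' (f p) \o gpush f p)%VF.

End GPush.

Section Product.
Context {R : realType} {m n : nat}.

Section ProductChart.
Context {S T : topologicalType} (c : chart R m S) (d : chart R n T).

Let dom : set (S * T) := cdom c `*` cdom d.
Let map (x : S * T) : 'rV[R]_(m + n) := row_mx (cmap c x.1) (cmap d x.2).
Let inv (y : 'rV[R]_(m + n)) : S * T := (cinv c (lsubmx y), cinv d (rsubmx y)).

Let prod_imgE (A : set S) (B : set T) :
  map @` (A `*` B) = (lsubmx @^-1` (cmap c @` A)) `&` (rsubmx @^-1` (cmap d @` B)).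
Proof.
apply/seteqP; split=> [_ [[x y] [/= Ax By] <-]|z [[x Ax zx] [y By zy]]].
  by rewrite /map /=; split=> /=; rewrite ?row_mxKl ?row_mxKr; [exists x|exists y].
by exists (x, y) => //; rewrite /map /= zx zy hsubmxK.
Qed.

Fact prod_dom_open : open dom.
Proof.
rewrite openE => -[x y] [/= cx dy].
exists (cdom c, cdom d) => //; split; apply: open_nbhs_nbhs; split=> //;
  exact: cdom_open.
Qed.

Fact prod_img_open : open (map @` dom).
Proof.
rewrite prod_imgE; apply: openI; apply: open_comp; try exact: cimg_open.
  by move=> x _; exact: (@continuous_lsubmx R 1 m n x).
by move=> x _; exact: (@continuous_rsubmx R 1 m n x).
Qed.

Fact prod_mapK x : dom x -> inv (map x) = x.
Proof.
by case: x => x y [/= cx dy]; rewrite /inv /map row_mxKl row_mxKr !cmapK.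
Qed.

Fact prod_map_continuous x : dom x -> {for x, continuous map}.
Proof.
case: x => x y [/= cx dy].
apply: (@continuous_row_mx _ _ _ _ (cmap c \o fst) (cmap d \o snd)).
  by apply: continuous_comp; [exact: cvg_fst|exact: cmap_continuous].
by apply: continuous_comp; [exact: cvg_snd|exact: cmap_continuous].
Qed.

Fact prod_inv_continuous y : (map @` dom) y -> {for y, continuous inv}.
Proof.
rewrite prod_imgE => -[/= cy dy].
have H1 : {for y, continuous (cinv c \o lsubmx : 'rV[R]_(m + n) -> S)}.
  by apply: continuous_comp; [exact: (@continuous_lsubmx R 1 m n)|exact: cinv_continuous].
have H2 : {for y, continuous (cinv d \o rsubmx : 'rV[R]_(m + n) -> T)}.
  by apply: continuous_comp; [exact: (@continuous_rsubmx R 1 m n)|exact: cinv_continuous].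
exact: (cvg_pair H1 H2).
Qed.

Definition prod_chart : chart R (m + n) (S * T)%type :=
  Chart prod_dom_open prod_img_open prod_mapK prod_map_continuous
    prod_inv_continuous.

Lemma prod_chart_imgE (A : set S) (B : set T) :
  cmap prod_chart @` (A `*` B) =
  (lsubmx @^-1` (cmap c @` A)) `&` (rsubmx @^-1` (cmap d @` B)).
Proof. exact: prod_imgE. Qed.

End ProductChart.

Lemma prod_chart_compatible (S T : topologicalType) (c c' : chart R m S)
    (d d' : chart R n T) :
  compatible c c' -> compatible d d' ->
  compatible (prod_chart c d) (prod_chart c' d').
Proof.
have domE : cdom (prod_chart c d) `&` cdom (prod_chart c' d') =
            (cdom c `&` cdom c') `*` (cdom d `&` cdom d').
  apply/seteqP; split=> [[x y] [[/= ? ?] [/= ? ?]]|[x y] [[/= ? ?] [/= ? ?]]];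
  by split; split.
move=> [cc' c'c] [dd' d'd]; split; rewrite domE prod_chart_imgE.
  have [oc od] := (@transition_open _ _ _ c c', @transition_open _ _ _ d d').
  exact: smooth_on_row_mx oc od cc' dd'.
have [oc od] := (@transition_open _ _ _ c' c, @transition_open _ _ _ d' d).
rewrite [_ `&` cdom c]setIC in oc; rewrite [_ `&` cdom d]setIC in od.
exact: smooth_on_row_mx oc od c'c d'd.
Qed.

Variables (M : manifold R m) (N : manifold R n).

Definition prod_atlas : set (chart R (m + n) (M * N)%type) :=
  [set prod_chart c.1 c.2 | c in atlas M `*` atlas N].

Fact prod_atlas_cover (x : M * N) : exists2 c, prod_atlas c & cdom c x.
Proof.
have [c Mc cx] := atlas_cover x.1; have [d Nd dx] := atlas_cover x.2.
by exists (prod_chart c d) => //; exists (c, d).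
Qed.

Fact prod_atlas_compatible c d : prod_atlas c -> prod_atlas d -> compatible c d.
Proof.
move=> [[c1 c2] [/= Mc1 Nc2] <-] [[d1 d2] [/= Md1 Nd2] <-].
by apply: prod_chart_compatible; exact: atlas_compatible.
Qed.

Fact prod_hausdorff : hausdorff_space (M * N)%type.
Proof.
move=> [x1 x2] [y1 y2] clxy; congr pair.
  apply: manifold_hausdorff => A B xA yB.
  have HA : nbhs (x1, x2) (fst @^-1` A) by exact: (@cvg_fst _ _ (nbhs x1) (nbhs x2)).
  have HB : nbhs (y1, y2) (fst @^-1` B) by exact: (@cvg_fst _ _ (nbhs y1) (nbhs y2)).
  by have [[z1 z2] [/= ? ?]] := clxy _ _ HA HB; exists z1.
apply: manifold_hausdorff => A B xA yB.
have HA : nbhs (x1, x2) (snd @^-1` A) by exact: (@cvg_snd _ _ (nbhs x1) (nbhs x2)).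
have HB : nbhs (y1, y2) (snd @^-1` B) by exact: (@cvg_snd _ _ (nbhs y1) (nbhs y2)).
by have [[z1 z2] [/= ? ?]] := clxy _ _ HA HB; exists z2.
Qed.

Fact prod_second_countable : @second_countable (M * N)%type.
Proof.
have [A cA [oA bA]] := manifold_second_countable M.
have [B cB [oB bB]] := manifold_second_countable N.
exists [set U.1 `*` U.2 | U in A `*` B].
  by apply: (sub_countable (card_image_le _ _)); exact: countableX.
split.
  move=> _ [[U V] [/= AU BV] <-].
  rewrite openE => -[x y] [/= Ux Vy].
  by exists (U, V) => //; split; apply: open_nbhs_nbhs; split=> //; [exact: oA|exact: oB].
move=> [x y] W [[U V] [/= xU yV] UVW].
have [U' [/= AU' U'x] U'U] := bA x U xU.
have [V' [/= BV' V'y] V'V] := bB y V yV.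
exists (U' `*` V').
  by split=> //; exists (U', V').
by move=> [a b] [/= /U'U Ua /V'V Vb]; apply: UVW.
Qed.

Definition prod_manifold : manifold R (m + n) :=
  Manifold prod_atlas_cover prod_atlas_compatible prod_hausdorff
    prod_second_countable.

Definition prod_fst (q : prod_manifold) : M := q.1.
Definition prod_snd (q : prod_manifold) : N := q.2.

(* T_q (M x N) -> T_{q.1} M + T_{q.2} N, (d pr_1, d pr_2) *)
Definition prod_tangent_fun (q : prod_manifold) (v : tangent q) :
    tangent (prod_fst q) * tangent (prod_snd q) :=
  (mdiff prod_fst q v, mdiff prod_snd q v).

Fact prod_tangent_linear q : linear (@prod_tangent_fun q).
Proof. by move=> a u v; rewrite /prod_tangent_fun !linearP. Qed.

HB.instance Definition _ q :=
  GRing.isLinear.Build R _ _ _ (@prod_tangent_fun q) (@prod_tangent_linear q).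

Definition prod_tangent (q : prod_manifold) :
    'Hom(tangent q, (tangent (prod_fst q) * tangent (prod_snd q))%type) :=
  linfun (@prod_tangent_fun q).

Definition twisted_product (JM : forall p : M, 'End(gtangent p))
    (JN : forall p : N, 'End(gtangent p)) (q : prod_manifold) :
    'End(gtangent q) :=
  gen_sum (prod_tangent q) (twist (JM (prod_fst q))) (JN (prod_snd q)).

Definition graph (f : M -> N) : set prod_manifold :=
  [set q | prod_snd q = f (prod_fst q)].

End Product.
Arguments prod_fst {R m n M N} q.
Arguments prod_snd {R m n M N} q.

Section ProductTangent.
Context {R : realType} {m n : nat} {M : manifold R m} {N : manifold R n}.
Implicit Types (q : prod_manifold M N).

Lemma smooth_prod_fst : smooth_map (@prod_fst R m n M N).
Proof.
split=> [[x y]|c c' /= [[d1 d2] [/= Md1 Nd2] <-] Mc']; first exact: cvg_fst.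
move=> k; have [cc' _] := atlas_compatible Md1 Mc'.
set U := cmap d1 @` (cdom d1 `&` cdom c').
have oU : open U by exact: (@transition_open _ _ _ d1 c').
have Hk : Ck k (lsubmx @^-1` U : set 'rV[R]_(m + n))
    (fun x => (cmap c' \o cinv d1) (lsubmx x)).
  exact: (@Ck_comp_linear R _ _ _ lsubmx k U (cmap c' \o cinv d1) oU
    (@continuous_lsubmx R 1 m n) (cc' k)).
apply: CkSub Hk => _ [[x y] [[/= d1x d2y] /= c'x] <-].
by rewrite /= row_mxKl; exists x.
Qed.

Lemma smooth_prod_snd : smooth_map (@prod_snd R m n M N).
Proof.
split=> [[x y]|c c' /= [[d1 d2] [/= Md1 Nd2] <-] Nc']; first exact: cvg_snd.
move=> k; have [cc' _] := atlas_compatible Nd2 Nc'.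
set U := cmap d2 @` (cdom d2 `&` cdom c').
have oU : open U by exact: (@transition_open _ _ _ d2 c').
have Hk : Ck k (rsubmx @^-1` U : set 'rV[R]_(m + n))
    (fun x => (cmap c' \o cinv d2) (rsubmx x)).
  exact: (@Ck_comp_linear R _ _ _ rsubmx k U (cmap c' \o cinv d2) oU
    (@continuous_rsubmx R 1 m n) (cc' k)).
apply: CkSub Hk => _ [[x y] [[/= d1x d2y] /= c'y] <-].
by rewrite /= row_mxKr; exists y.
Qed.

Lemma prod_chart_at q c d : chart_at (prod_fst q) c -> chart_at (prod_snd q) d ->
  chart_at q (prod_chart c d).
Proof. by move=> [Mc cq] [Nd dq]; split=> //; exists (c, d). Qed.

Lemma prod_tangent_coord q c d (v : tangent q) :
  chart_at (prod_fst q) c -> chart_at (prod_snd q) d ->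
  tcoord c (prod_tangent q v).1 = lsubmx (@tcoord R _ (prod_manifold M N) q (prod_chart c d) v) /\
  tcoord d (prod_tangent q v).2 = rsubmx (@tcoord R _ (prod_manifold M N) q (prod_chart c d) v).
Proof.
move=> qc qd; have qcd := prod_chart_at qc qd.
have nq : nbhs (cmap (prod_chart c d) q)
    (cmap (prod_chart c d) @` cdom (prod_chart c d)).
  apply: open_nbhs_nbhs; split; first exact: cimg_open.
  by exists q => //; exact: qcd.2.
rewrite /prod_tangent lfunE /=; split.
  rewrite (mdiffE v smooth_prod_fst qcd qc).
  have [] := @near_eq_diff _ _ _ lsubmx
      (cmap c \o (@prod_fst R m n M N) \o cinv (prod_chart c d)) (cmap (prod_chart c d) q).
  - by apply: filterS nq => _ [[x y] [/= cx dy] <-] /=; rewrite row_mxKl cmapK.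
  - exact: differentiable_lsubmx.
  move=> _ H; etransitivity; first exact: (congr1 (@^~ _) H).
  exact: (congr1 (@^~ _) (@diff_lin _ _ _ lsubmx _ (@continuous_lsubmx R 1 m n))).
rewrite (mdiffE v smooth_prod_snd qcd qd).
have [] := @near_eq_diff _ _ _ rsubmx
    (cmap d \o (@prod_snd R m n M N) \o cinv (prod_chart c d)) (cmap (prod_chart c d) q).
- by apply: filterS nq => _ [[x y] [/= cx dy] <-] /=; rewrite row_mxKr cmapK.
- exact: differentiable_rsubmx.
move=> _ H; etransitivity; first exact: (congr1 (@^~ _) H).
exact: (congr1 (@^~ _) (@diff_lin _ _ _ rsubmx _ (@continuous_rsubmx R 1 m n))).
Qed.

Lemma prod_tangent_bij q : bijective (prod_tangent q).
Proof.
have qc := default_chartP (prod_fst q); have qd := default_chartP (prod_snd q).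
move: (default_chart (prod_fst q)) (default_chart (prod_snd q)) qc qd => c d qc qd.
have qcd := prod_chart_at qc qd.
exists (fun w => tvec q (prod_chart c d) (row_mx (tcoord c w.1) (tcoord d w.2))).
  move=> v; have [-> ->] := prod_tangent_coord v qc qd.
  by rewrite hsubmxK tcoordK.
move=> w; set v := tvec _ _ _.
have [] := prod_tangent_coord v qc qd; rewrite /v tvecK // row_mxKl row_mxKr.
move=> /(can_inj (tcoordK qc)) E1 /(can_inj (tcoordK qd)) E2.
by rewrite [LHS]surjective_pairing E1 E2 -surjective_pairing.
Qed.

End ProductTangent.

(* Main.v *)
Require Import Defs.
From HB Require Import structures.
From mathcomp Require Import all_boot all_order all_algebra.
From mathcomp Require Import boolp classical_sets functions.
From mathcomp Require Import reals topology normedtype derive.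

(* The graph of phi has, at (p, phi p), the graph of A = d phi_p as tangent space,
   and its annihilator consists of the pairs of covectors (- eta \o A, eta). So
   with xi = eta \o A the vector ((x, A x), (- xi, eta)) lies in the bundle that
   the twisted product structure preserves; since the twist of J_M sends (x, - xi)
   to (y, - zeta) when J_M sends (x, xi) to (y, zeta), stability says exactly that
   J_N sends (A x, eta) to (A y, (A^* )^-1 zeta). *)

Set Implicit Arguments.
Unset Strict Implicit.
Unset Printing Implicit Defensive.

Import Order.TTheory GRing.Theory Num.Theory.
Import numFieldNormedType.Exports.

Local Open Scope classical_set_scope.
Local Open Scope ring_scope.

(** * Inverses, duals and twists of linear maps *)

Section LinearAlgebra.
Context {K : fieldType}.

Lemma surj_lfunVK (V W : vectType K) (f : 'Hom(V, W)) :
  (forall y, exists x, f x = y) -> cancel f^-1%VF f.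
Proof.
by move=> fS y; have [x <-] := fS y; rewrite limg_lfunVK// memv_img ?memvf.
Qed.

Lemma inj_lfunK (V W : vectType K) (f : 'Hom(V, W)) :
  injective f -> cancel f f^-1%VF.
Proof. by move=> fI; apply: lker0_lfunK; apply/lker0P. Qed.

(** The witness [f^-1 y] works because [f] cancels [f^-1], once on the argument and once on the
    value. For [f := gen_split F] the conjugate is [gen_sum]. *)
Lemma surj_inv_conj (V W : vectType K) (f : 'Hom(V, W)) (h : 'End(W)) :
  (forall y, exists x, f x = y) ->
  forall y, exists x, f x = y /\ f ((f^-1 \o h \o f)%VF x) = h y.
Proof.
move=> /surj_lfunVK fK y; exists (f^-1%VF y); split; first exact: fK.
by rewrite 2!comp_lfunE 2!fK.
Qed.

Section DualMap.
Context {V W : vectType K} (f : 'Hom(V, W)).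

Lemma dual_mapE eta x : dual_map f eta x = eta (f x).
Proof. by rewrite /dual_map lfunE /= comp_lfunE. Qed.

Lemma dual_map_inj : (forall y, exists x, f x = y) -> injective (dual_map f).
Proof.
move=> fS a b ab; apply/lfunP => y; have [x <-] := fS y.
by rewrite -!dual_mapE ab.
Qed.

Lemma dual_map_surj : injective f -> forall xi, exists eta, dual_map f eta = xi.
Proof.
move=> fI xi; exists (xi \o f^-1)%VF; apply/lfunP => x.
by rewrite dual_mapE comp_lfunE inj_lfunK.
Qed.

End DualMap.

Lemma lfun_pairE (A B C D : vectType K) (f : 'Hom(A, C)) (g : 'Hom(B, D)) x y :
  lfun_pair f g (x, y) = (f x, g y).
Proof. by rewrite /lfun_pair lfunE. Qed.

(** The twist is the conjugate of [J] by the sign change [(x, xi) |-> (x, - xi)]. *)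
Lemma twistE (V : vectType K) (J : 'End(gspace V)) x xi :
  twist J (x, - xi) = ((J (x, xi)).1, - (J (x, xi)).2).
Proof. by rewrite /twist lfunE /= twist_funE /= opprK. Qed.

(** * Direct sums of operators and stability along a graph *)

Section GraphSum.
Context {V V1 V2 : vectType K} (F : 'Hom(V, (V1 * V2)%type)).
Hypothesis F_bij : bijective F.

Lemma gen_split_surj w : exists u, gen_split F u = w.
Proof.
have FVK : cancel F^-1%VF F.
  by case: F_bij => g _ Fg; apply: surj_lfunVK => y; exists (g y).
case: w => [[x xi] [y eta]].
pose p1 : 'Hom((V1 * V2)%type, V1) := linfun fst.
pose p2 : 'Hom((V1 * V2)%type, V2) := linfun snd.
(* The covector is the sum of the pullbacks of [xi] and [eta] along the two components of [F]. *)
exists ((F^-1)%VF (x, y), (xi \o p1 \o F)%VF + (eta \o p2 \o F)%VF).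
rewrite /gen_split lfunE /= /gen_split_fun /=.
congr ((_, _), (_, _)); rewrite ?FVK //=; apply/lfunP => z.
  rewrite !comp_lfunE /= add_lfunE !comp_lfunE FVK /p1 /p2 /lfun_inl !lfunE /=.
  by rewrite linear0 addr0.
rewrite !comp_lfunE /= add_lfunE !comp_lfunE FVK /p1 /p2 /lfun_inr !lfunE /=.
by rewrite linear0 add0r.
Qed.

(** Every [v] is the sum of the preimages of [((F v).1, 0)] and [(0, (F v).2)], on which [u.2] is
    given by [xi] and [eta]. *)
Lemma gen_splitP u x xi y eta : gen_split F u = ((x, xi), (y, eta)) ->
  F u.1 = (x, y) /\ forall v, u.2 v = xi (F v).1 + eta (F v).2.
Proof.
rewrite /gen_split lfunE /= /gen_split_fun => -[<- <- <- <-].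
split=> [|v]; first by rewrite -surjective_pairing.
rewrite !comp_lfunE /lfun_inl /lfun_inr !lfunE /= /inl_fun /inr_fun.
rewrite -!linearD /= -[in LHS](inj_lfunK (bij_inj F_bij) v).
by congr (u.2 (F^-1%VF _)); rewrite [LHS]surjective_pairing; congr pair => /=;
  rewrite ?addr0 ?add0r.
Qed.

Lemma gen_sum_surj (J1 : 'End(gspace V1)) (J2 : 'End(gspace V2))
    (w : gspace V1 * gspace V2) :
  exists u, gen_split F u = w /\
    gen_split F (gen_sum F J1 J2 u) = (J1 w.1, J2 w.2).
Proof.
have [u [uE GE]] := surj_inv_conj (lfun_pair J1 J2) gen_split_surj w.
exists u; split; first exact uE.
refine (etrans GE _); case: w {uE GE} => w1 w2.
by rewrite lfun_pairE.
Qed.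

(** The statement in a single fibre: [T] is the graph of [A] seen through the splitting [F], kept as
    a bare set because [tangent_sub] is one. *)
Lemma graph_stable_intertwine (A : 'Hom(V1, V2)) (J1 : 'End(gspace V1))
    (J2 : 'End(gspace V2)) (T : set V) : bijective A ->
  (forall v, T v <-> (F v).2 = A (F v).1) ->
  (forall u : gspace V, T u.1 -> (forall v, T v -> u.2 v = 0) ->
     let u' := gen_sum F (twist J1) J2 u in
     T u'.1 /\ (forall v, T v -> u'.2 v = 0)) ->
  (lfun_pair A (dual_map A)^-1 \o J1 = J2 \o lfun_pair A (dual_map A)^-1)%VF.
Proof.
move=> A_bij TE JT; have AI := bij_inj A_bij.
have AS y : exists x, A x = y by case: A_bij => B _ AB; exists (B y).
have F_surj : forall y, exists v, F v = y.
  by case: F_bij => G _ FG y; exists (G y).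
have dAVK := surj_lfunVK (dual_map_surj AI).
have dAK := inj_lfunK (dual_map_inj AS).
apply/lfunP => -[x xi]; rewrite 2!comp_lfunE lfun_pairE.
set eta := (dual_map A)^-1%VF xi.
have xiE z : eta (A z) = xi z by rewrite -dual_mapE dAVK.
have [u [uE]] := gen_sum_surj (twist J1) J2 ((x, - xi), (A x, eta)).
have [u1 u2] := gen_splitP uE.
have [] := JT u.
- by apply/TE; rewrite u1.
(* On a vector over [(z, A z)] the covector takes the value [- xi z + eta (A z)], zero by the choice
   of [eta]. *)
- by move=> v /TE vT; rewrite u2 vT xiE opp_lfunE addNr.
rewrite twistE; move: (gen_sum _ _ _ _) => u' /=.
case: (J1 _) => y zeta; case: (J2 _) => y' zeta' /= + + /gen_splitP [u'1 u'2].
move=> /TE; rewrite u'1 /= => -> E2; rewrite lfun_pairE; congr pair.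
(* Tangency has given [y' = A y]. For the covectors it remains to see [zeta z = zeta' (A z)], which
   is the annihilator condition on the vector [v] over [(z, A z)]. *)
rewrite -[RHS]dAK; congr (_ _); apply/lfunP => z; rewrite dual_mapE.
have [v Fv] := F_surj (z, A z).
have := E2 v; rewrite u'2 Fv /= opp_lfunE => H.
have /H/eqP : T v by apply/TE; rewrite Fv.
by rewrite addrC subr_eq0 => /eqP ->.
Qed.

End GraphSum.
End LinearAlgebra.

(** * Chain rule and smoothness along straight lines *)

Section Smoothness.
Context {R : realType}.

Lemma diff_compE (U V W : normedModType R) (f : U -> V) (g : V -> W) x v :
  differentiable f x -> differentiable g (f x) ->
  'd (g \o f) x v = 'd g (f x) ('d f x v).
Proof. by move=> df dg; exact: (congr1 (@^~ v) (diff_comp df dg)). Qed.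

Lemma eq_diff (V W : normedModType R) (f g : V -> W) x v :
  differentiable f x -> (\forall y \near x, f y = g y) -> 'd g x v = 'd f x v.
Proof.
by move=> df fg; have [_ E] := near_eq_diff fg df; exact: (congr1 (@^~ v) E).
Qed.

Lemma diff_linear_comp (V W W' : normedModType R) (L : {linear W -> W'})
    (f : V -> W) x v : continuous L -> differentiable f x ->
  'd (fun y => L (f y)) x v = L ('d f x v).
Proof.
move=> cL df; rewrite [LHS](@diff_compE _ _ _ f L)//; last first.
  exact: linear_differentiable.
exact: (congr1 (@^~ _) (diff_lin _ cL)).
Qed.

Lemma diff_lsubmx (V : normedModType R) m n (f : V -> 'rV[R]_(m + n)) x v :
  differentiable f x -> 'd (fun y => lsubmx (f y)) x v = lsubmx ('d f x v).
Proof.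
exact: (@diff_linear_comp _ _ _ lsubmx f x v (@continuous_lsubmx R 1 m n)).
Qed.

Lemma diff_rsubmx (V : normedModType R) m n (f : V -> 'rV[R]_(m + n)) x v :
  differentiable f x -> 'd (fun y => rsubmx (f y)) x v = rsubmx ('d f x v).
Proof.
exact: (@diff_linear_comp _ _ _ rsubmx f x v (@continuous_rsubmx R 1 m n)).
Qed.

Lemma nbhs0_itvoo (e : R) : 0 < e -> \forall t \near (0 : R), - e < t < e.
Proof.
move=> e0; apply/nbhs_ballP; exists e => // t.
by rewrite /ball /= sub0r normrN ltr_norml.
Qed.

Section Line.
Context {V : normedModType R}.
Variables (x w : V).

Definition line (t : R) : V := x + t *: w.

Lemma line_continuous : continuous line.
Proof.
by move=> t; apply: cvgD; [exact: cvg_cst|apply: cvgZr_tmp; exact: cvg_id].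
Qed.

Lemma line_is_diff t : is_diff t line ( *:%R^~ w).
Proof.
have -> : line = cst x + ( *:%R^~ w) by [].
by rewrite -[X in is_diff _ _ X]add0r; apply: is_diffD.
Qed.

Lemma line_differentiable t : differentiable line t.
Proof. by have [] := line_is_diff t. Qed.

Lemma diff_line t s : 'd line t s = s *: w.
Proof. by have [_ ->] := line_is_diff t. Qed.

(** The derivative of [f \o line] in direction [s] is the derivative of [f] in the fixed direction
    [s *: w], again composed with the line, so the induction closes up. *)
Lemma Ck_line (W : normedModType R) k (U : set V) (f : V -> W) : open U ->
  Ck k U f -> Ck k (line @^-1` U) (f \o line).
Proof.
move=> oU; elim: k f => [|k IH] f /= Hf.
  by move=> t Ut; apply: continuous_comp; [exact: line_continuous|exact: Hf].
have oLU : open (line @^-1` U).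
  by apply: open_comp => // t _; exact: line_continuous.
case: Hf => df Cf; split=> [t Ut|s].
  by apply: differentiable_comp; [exact: line_differentiable|exact: df].
apply: (eq_Ck oLU) (IH _ (Cf (s *: w))) => t Ut.
by rewrite diff_compE; [rewrite diff_line|exact: line_differentiable|exact: df].
Qed.

End Line.

(** The row is the sum of the images of [f] and [g] under the linear inclusions of the blocks. Both
    maps share one variable, as the components of a curve in a product do. *)
Lemma smooth_row_mx (V : normedModType R) m n (U1 U2 : set V)
    (f : V -> 'rV[R]_m) (g : V -> 'rV[R]_n) : open U1 -> open U2 ->
  smooth_on U1 f -> smooth_on U2 g ->
  smooth_on (U1 `&` U2) (fun x => row_mx (f x) (g x)).
Proof.
move=> o1 o2 sf sg k.
have cl : continuous (@inl_mx R m n).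
  move=> x; apply: (@continuous_row_mx _ _ _ _ id (cst 0) x);
    [exact: cvg_id|exact: cst_continuous].
have cr : continuous (@inr_mx R m n).
  move=> x; apply: (@continuous_row_mx _ _ _ _ (cst 0) id x);
    [exact: cst_continuous|exact: cvg_id].
have oU := openI o1 o2.
apply: (@eq_Ck _ _ _ _ _ (fun x => inl_mx n (f x) + inr_mx m (g x))) => //.
  by move=> x _; rewrite /inl_mx /inr_mx add_row_mx addr0 add0r.
by apply: CkD => //; apply: Ck_linear_comp => //;
  [apply: (CkSub _ (sf k)) => x []|apply: (CkSub _ (sg k)) => x []].
Qed.

End Smoothness.

(** * Differentials of diffeomorphisms *)

Section Diffeo.
Context {R : realType} {m n : nat} {M : manifold R m} {N : manifold R n}.

(** By the chain rule this is the differential of [g \o f] read in [c], which near the point is the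
    transition from [c] to itself. Coordinates are used because [mdiff g (f p)] takes values in
    [tangent (g (f p))], a type distinct from [tangent p]. *)
Lemma diff_coord_cancel (f : M -> N) (g : N -> M) p c d (w : 'rV[R]_m) :
  smooth_map f -> smooth_map g -> cancel f g ->
  chart_at p c -> chart_at (f p) d ->
  'd (cmap c \o g \o cinv d) (cmap d (f p))
    ('d (cmap d \o f \o cinv c) (cmap c p) w) = w.
Proof.
move=> sf sg fK pc qd; have [Mc cp] := pc; have [Nd dq] := qd.
have qc : chart_at (g (f p)) c by rewrite fK.
have df := smooth_map_differentiable sf pc qd.
have dg := smooth_map_differentiable sg qd qc.
have E : (cmap d \o f \o cinv c) (cmap c p) = cmap d (f p) by rewrite /= cmapK.
rewrite -[X in 'd _ X ('d _ _ _)]E -E in dg *.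
rewrite -diff_compE //.
rewrite -[RHS](transition_id w pc); symmetry.
apply: eq_diff; first exact: differentiable_comp.
(* The two maps are compared where [f \o cinv c] lands in the domain of [d], a neighbourhood of the
   point by continuity. *)
have cf : {for cmap c p, continuous (f \o cinv c)}.
  apply: continuous_comp; last exact: (proj1 sf).
  by apply: cinv_continuous; exists p.
have nc : nbhs (cmap c p) (cmap c @` cdom c).
  by apply: open_nbhs_nbhs; split; [exact: cimg_open|exists p].
have nd : \forall y \near cmap c p, cdom d (f (cinv c y)).
  apply: cf; apply: open_nbhs_nbhs; split; first exact: cdom_open.
  by rewrite /= cmapK.
apply: filterS2 nc nd => _ [x cx <-] /=; rewrite cmapK // => dx.
by rewrite cmapK // fK.
Qed.

End Diffeo.

Lemma mdiff_bij (R : realType) m n (M : manifold R m) (N : manifold R n)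
    (f : M -> N) p : diffeomorphism f -> bijective (mdiff f p).
Proof.
move=> [sf [g [sg fK gK]]].
have pc := default_chartP p; have qd := default_chartP (f p).
move: (default_chart p) (default_chart (f p)) pc qd => c d pc qd.
exists (fun v => tvec p c
  ('d (cmap c \o g \o cinv d) (cmap d (f p)) (tcoord d v))) => v.
  rewrite (mdiffE _ sf pc qd) diff_coord_cancel //.
  exact: tcoordK.
apply: (can_inj (tcoordK qd)); rewrite (mdiffE _ sf pc qd) tvecK //.
have pc' : chart_at (g (f p)) c by rewrite fK.
by have := diff_coord_cancel (tcoord d v) sg sf gK qd pc'; rewrite fK.
Qed.

(** * Tangent space of the graph *)

Section GraphTangent.
Context {R : realType} {m n : nat} {M : manifold R m} {N : manifold R n}.
Variables (f : M -> N) (p : M).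
Hypothesis sf : smooth_map f.

Let q : prod_manifold M N := (p, f p).

(** Inside the open image of [c] the set is cut out by the preimage of [cdom d] under [f \o cinv c],
    continuous there. [Ck_line] asks for this openness. *)
Lemma chart_preimage_open (c : chart R m M) (d : chart R n N) :
  open (cmap c @` (cdom c `&` f @^-1` cdom d)).
Proof.
have -> : cmap c @` (cdom c `&` f @^-1` cdom d) =
          (cmap c @` cdom c) `&` ((f \o cinv c) @^-1` cdom d).
  apply/seteqP; split=> [_ [x [cx dx] <-]|_ [[x cx <-]]].
    by split; [exists x|rewrite /= cmapK].
  by rewrite /= cmapK // => dx; exists x.
rewrite openE => y [cy dy]; apply: filterI.
  by apply: open_nbhs_nbhs; split=> //; exact: cimg_open.
have cfy : {for y, continuous (f \o cinv c)}.
  by apply: continuous_comp; [exact: cinv_continuous|exact: (proj1 sf)].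
by apply: cfy; apply: open_nbhs_nbhs; split=> //; exact: cdom_open.
Qed.

(** A curve in the graph has the form [t |-> (a t, f (a t))]; the chain rule at 0 gives the second
    component of its velocity from the first. *)
Lemma tangent_sub_graph_mdiff (v : tangent q) : tangent_sub (graph f) v ->
  (prod_tangent q v).2 = mdiff f p (prod_tangent q v).1.
Proof.
move=> [e [g [e0 [cg sg] gS [g0 vg]]]].
have pc := default_chartP p; have qd := default_chartP (f p).
move: (default_chart p) (default_chart (f p)) pc qd => c d pc qd.
have qcd : chart_at q (prod_chart c d) by exact: prod_chart_at.
have [E1 E2] := @prod_tangent_coord _ _ _ _ _ q c d v pc qd.
apply: (can_inj (tcoordK qd)); rewrite (mdiffE _ sf pc qd) E1 {E1}.
apply: etrans E2 _.
rewrite (vg _ qcd); set G := cmap (prod_chart c d) \o g.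
have I0 : - e < (0 : R) < e by rewrite e0 oppr_lt0 e0.
have dG : differentiable G 0.
  have [H _] := sg _ qcd.1 1%N.
  by apply: H; split=> //=; rewrite g0; exact: qcd.2.
rewrite derive1E' //.
have G0 : lsubmx (G 0) = cmap c p by rewrite /G /= g0 row_mxKl.
have dlG : differentiable (fun t => lsubmx (G t)) 0.
  exact: (differentiable_comp dG (differentiable_lsubmx _)).
have df := smooth_map_differentiable sf pc qd; rewrite -G0 in df *.
have El := diff_lsubmx (1 : R) dG; have Er := diff_rsubmx (1 : R) dG.
rewrite -El -Er; apply: etrans (diff_compE (1 : R) dlG df).
(* Near 0 the curve stays in the graph and in the product chart, so its second block is the
   expression of [f] applied to its first. *)
apply: eq_diff; first exact: (differentiable_comp dlG df).
have nI := nbhs0_itvoo e0.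
have nq : \forall t \near (0 : R), cdom (prod_chart c d) (g t).
  apply: (cg 0 I0); apply: open_nbhs_nbhs; split; first exact: cdom_open.
  by rewrite g0; exact: qcd.2.
apply: filterS2 nI nq => t /gS gt [/= ct dt].
by rewrite row_mxKl row_mxKr cmapK// -gt.
Qed.

(** The curve is the straight line with direction [w] in a chart of [M], lifted to the graph. *)
Lemma mdiff_tangent_sub_graph (v : tangent q) :
  (prod_tangent q v).2 = mdiff f p (prod_tangent q v).1 ->
  tangent_sub (graph f) v.
Proof.
move=> vE; have pc := default_chartP p; have [Mc cp] := pc.
move: (default_chart p) pc Mc cp => c pc Mc cp.
pose w := tcoord c (prod_tangent q v).1.
pose L := line (cmap c p) w.
have L0 : L 0 = cmap c p by rewrite /L /line scale0r addr0.
(* This [e] keeps the line inside the image of the chart, where [cinv c] is meaningful. *)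
have [e /= e0 eU] : exists2 e : R, 0 < e &
    forall t, - e < t < e -> (cmap c @` cdom c) (L t).
  have : \forall t \near (0 : R), (cmap c @` cdom c) (L t).
    have cL : {for 0, continuous L} by exact: line_continuous.
    apply: cL; apply: open_nbhs_nbhs; rewrite L0.
    by split; [exact: cimg_open|exists p].
  move=> /nbhs_ballP[e /= e0 eU]; exists e => // t te; apply: eU.
  by rewrite /ball /= sub0r normrN ltr_norml.
pose a t := cinv c (L t).
have ca t : - e < t < e -> {for t, continuous a}.
  move=> /eU Ut; apply: continuous_comp; first exact: line_continuous.
  exact: cinv_continuous.
have dma t : - e < t < e -> cdom c (a t).
  by move=> /eU[x cx]; rewrite /a => <-; rewrite cmapK.
have mca t : - e < t < e -> cmap c (a t) = L t.
  by move=> /eU[x cx]; rewrite /a => <-; rewrite cmapK.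
have a0 : a 0 = p by rewrite /a L0 cmapK.
pose g t : prod_manifold M N := (a t, f (a t)).
have sg : smooth_curve e g.
  split=> [t te|_ [[c' d'] [/= Mc' Nd'] <-]].
    apply: cvg_pair; first exact: ca.
    by apply: (@continuous_comp _ _ _ a f); [exact: ca|exact: (proj1 sf)].
  have [cc' _] := atlas_compatible Mc Mc'.
  have cfd' := sf.2 _ _ Mc Nd'.
  have o1 := @transition_open _ _ _ c c'.
  have o2 := @chart_preimage_open c d'.
  have lo (U : set 'rV[R]_m) : open U -> open (L @^-1` U).
    by move=> oU; apply: open_comp => // t _; exact: line_continuous.
  (* In a product chart the two blocks of the curve are a transition map and the expression of [f],
     each composed with the line. *)
  have := smooth_row_mx (lo _ o1) (lo _ o2)
    (fun k => Ck_line (cmap c p) w o1 (cc' k))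
    (fun k => Ck_line (cmap c p) w o2 (cfd' k)).
  move=> H k; apply: CkSub (H k) => t [te [/= c't d't]].
  by rewrite -/L -mca//; split; exists (a t) => //; split => //; exact: dma.
exists e, g; split => //; split; first by rewrite /g a0.
move=> _ [[[c' d'] [/= Mc' Nd'] <-] [/= c'p d'p]].
have pc' : chart_at p c' by [].
have qd' : chart_at (f p) d' by [].
have [E1 E2] := @prod_tangent_coord _ _ _ _ _ q c' d' v pc' qd'.
have qcd : chart_at q (prod_chart c' d') by exact: prod_chart_at.
set G := _ \o g; have dG : differentiable G 0.
  have [H _] := sg.2 _ qcd.1 1%N.
  by apply: H; split; rewrite /= ?a0 // oppr_lt0 e0.
have dL : differentiable L 0 by exact: line_differentiable.
have dLw : 'd L 0 (1 : R) = w by rewrite diff_line scale1r.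
have dc' := transition_differentiable pc pc'.
have df := smooth_map_differentiable sf pc qd'.
rewrite derive1E' // -[LHS]hsubmxK -[RHS]hsubmxK; congr row_mx.
  rewrite -diff_lsubmx // -E1 (tcoord_change _ pc pc') -/w.
  have -> : (fun t => lsubmx (G t)) = (cmap c' \o cinv c) \o L.
    by apply/funext => t; rewrite /G /= row_mxKl.
  (* Writing the point as [L 0] and [w] as ['d L 0 1] puts the goal in the form of the chain rule
     along the line. *)
  rewrite -L0 -dLw in dc' *.
  exact/esym/(diff_compE _ dL dc').
rewrite -diff_rsubmx // -[LHS]E2 vE (mdiffE _ sf pc qd') -/w.
have -> : (fun t => rsubmx (G t)) = (cmap d' \o f \o cinv c) \o L.
  by apply/funext => t; rewrite /G /= row_mxKr.
rewrite -L0 -dLw in df *.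
exact/esym/(diff_compE _ dL df).
Qed.

End GraphTangent.

(** * Application in the fibre over each point of the graph *)

Theorem theorem6p1 (R : realType) (m n : nat)
    (M : manifold R m) (N : manifold R n) (phi : M -> N)
    (JM : forall p : M, 'End(gtangent p)) (JN : forall q : N, 'End(gtangent q))
    (phi_diffeo : diffeomorphism phi)
    (JM_gacs : is_gacs JM) (JN_gacs : is_gacs JN)
    (graph_lagrangian :
       generalized_lagrangian (twisted_product JM JN) (graph phi)) :
  intertwines phi JM JN.
Proof.
move=> p; have [sphi _] := phi_diffeo; have [_ GL] := graph_lagrangian.
pose q : prod_manifold M N := (p, phi p).
(* [gpush phi p] and [twisted_product JM JN q] unfold to the operators of the linear statement, with
   [A := mdiff phi p] and [F := prod_tangent q]. *)
apply: (@graph_stable_intertwine _ _ _ _ (prod_tangent q) (prod_tangent_bij q)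
  _ _ _ (tangent_sub (graph phi) (p := q))).
(* Without [cbn], unification of [prod_fst q] with [p] inside the vector space
   structures diverges. *)
- by cbn [prod_snd prod_fst q fst snd]; exact (mdiff_bij p phi_diffeo).
- move=> v; split; first exact: tangent_sub_graph_mdiff.
  cbn [prod_snd prod_fst q fst snd] => H.
  exact (mdiff_tangent_sub_graph sphi H).
- by move=> u u1 u2; exact: (GL q (erefl _) u (conj u1 u2)).
Qed.
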